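(* Let $G$ be a group and let $\mathcal{X}$ be a uniform family of commensurable approximate subgroups of $G$. Then there is an approximate subgroup $H\subseteq G$ such that $H$ is commensurable with $\mathcal{X}$ and $H$ is invariant under all automorphisms of $G$ stabilizing $\mathcal{X}$ set-wise (that is, $\sigma(H)=H$ for every automorphism $\sigma$ of $G$ with $\{\sigma(X):X\in\mathcal{X}\}=\mathcal{X}$).
   Context: For $K\in\mathbb{N}^{>0}$ and a group $G$, a subset $A\subseteq G$ is a $K$-approximate subgroup if $1_G\in A$, $A=A^{-1}$, and there is $X\subseteq G$ with $|X|\le K$ and $AA\subseteq XA$. An approximate subgroup is a $K$-approximate subgroup for some $K\in\mathbb{N}^{>0}$. For $N\in\mathbb{N}^{>0}$, approximate subgroups $X,Y$ of $G$ are $N$-commensurable if there are $Z_0,Z_1\subseteq G$ with $\max\{|Z_0|,|Z_1|\}\le N$ such that $X\subseteq Z_0Y$ and $Y\subseteq Z_1X$; they are commensurable if they are $N$-commensurable for some $N\in\mathbb{N}^{>0}$. A family $\mathcal{X}$ of approximate subgroups of $G$ is uniformly $N$-commensurable if any $X,Y\in\mathcal{X}$ are $N$-commensurable. $\mathcal{X}$ is a uniform family of commensurable approximate subgroups if there are $K,N\in\mathbb{N}^{>0}$ such that $\mathcal{X}$ is a uniformly $N$-commensurable family of $K$-approximate subgroups. An approximate subgroup $H$ is commensurable with such a family $\mathcal{X}$ if it is commensurable with one (equivalently, any) member of $\mathcal{X}$. *)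

(* Defs.v *)
From mathcomp Require Import all_boot monoid.
From mathcomp Require Import boolp classical_sets functions cardinality.

Set Implicit Arguments.
Unset Strict Implicit.
Unset Printing Implicit Defensive.

Local Open Scope classical_set_scope.
Local Open Scope card_scope.
Local Open Scope group_scope.

Definition set_mul (G : groupType) (A B : set G) : set G :=
  [set a * b | a in A & b in B].

Definition set_inv (G : groupType) (A : set G) : set G :=
  [set a^-1 | a in A].

(* [`I_K] is the set of natural numbers less than [K], so [X #<= `I_K] says
   that [X] has at most [K] elements (in particular, that it is finite). *)
Definition approximate_subgroup_by (G : groupType) (K : nat) (A : set G) : Prop :=
  [/\ A 1, A = set_inv A &
      exists X : set G, X #<= `I_K /\ set_mul A A `<=` set_mul X A].

Definition approximate_subgroup (G : groupType) (A : set G) : Prop :=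
  exists K : nat, 0 < K /\ approximate_subgroup_by K A.

Definition commensurable_by (G : groupType) (N : nat) (X Y : set G) : Prop :=
  exists Z0 Z1 : set G,
    [/\ Z0 #<= `I_N, Z1 #<= `I_N, X `<=` set_mul Z0 Y & Y `<=` set_mul Z1 X].

Definition commensurable (G : groupType) (X Y : set G) : Prop :=
  exists N : nat, 0 < N /\ commensurable_by N X Y.

Definition uniform_commensurable_family (G : groupType) (F : set (set G)) : Prop :=
  exists K N : nat,
    [/\ 0 < K, 0 < N,
        forall X, F X -> approximate_subgroup_by K X &
        forall X Y, F X -> F Y -> commensurable_by N X Y].

(* "Commensurable with any member": for a nonempty uniform family this is the
   same as "commensurable with one member"
   (see [commensurable_with_familyP] below); it also makes sense for the empty
   family. *)
Definition commensurable_with_family (G : groupType) (H : set G)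
    (F : set (set G)) : Prop :=
  forall X, F X -> commensurable H X.

Lemma card_set_mul (G : groupType) (m n : nat) (A B : set G) :
  A #<= `I_m -> B #<= `I_n -> set_mul A B #<= `I_(m * n)%N.
Proof.
have enumI k (C : set G) : C #<= `I_k -> exists f : nat -> G, C `<=` f @` `I_k.
  move=> /pfcard_geP[->|[f]]; first by exists (fun=> 1).
  by exists f => x Cx; have [i Ii <-] := 'surj_f Cx; exists i.
move=> /enumI[f fA] /enumI[g gB].
pose h k := f (k %/ n) * g (k %% n).
apply: (@card_le_trans _ _ _ (h @` `I_(m * n)%N)); last exact: card_image_le.
apply: subset_card_le => _ [a Aa [b Bb <-]].
have [i /= im <-] := fA a Aa.
have [j /= jn <-] := gB b Bb.
have n0 : 0 < n by apply: leq_ltn_trans jn.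
exists (i * n + j)%N => /=.
  by rewrite (@leq_trans (i.+1 * n)%N) ?leq_mul2r ?im ?orbT// mulSn addnC ltn_add2r.
by rewrite /h divnMDl// modnMDl divn_small// addn0 modn_small.
Qed.

Lemma set_mulA (G : groupType) (A B C : set G) :
  set_mul A (set_mul B C) `<=` set_mul (set_mul A B) C.
Proof.
move=> _ [a Aa [_ [b Bb [c Cc <-]] <-]]; rewrite mulgA.
by exists (a * b); [exists a => //; exists b | exists c].
Qed.

Lemma set_mulS (G : groupType) (A B C : set G) :
  B `<=` C -> set_mul A B `<=` set_mul A C.
Proof. by move=> BC _ [a Aa [b Bb <-]]; exists a => //; exists b => //; apply: BC. Qed.

Lemma commensurable_trans (G : groupType) (X Y W : set G) :
  commensurable X Y -> commensurable Y W -> commensurable X W.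
Proof.
move=> [M [M0 [A [A' [cA cA' XAY YAX]]]]] [N [N0 [B [B' [cB cB' YBW WBY]]]]].
exists (M * N)%N; split; first by rewrite muln_gt0 M0.
exists (set_mul A B), (set_mul B' A'); split.
- exact: card_set_mul.
- by rewrite mulnC; exact: card_set_mul.
- by apply: subset_trans XAY _; apply: subset_trans (set_mulS YBW) (@set_mulA _ _ _ _).
- by apply: subset_trans WBY _; apply: subset_trans (set_mulS YAX) (@set_mulA _ _ _ _).
Qed.

Lemma commensurable_with_familyP (G : groupType) (F : set (set G)) (H : set G) :
  uniform_commensurable_family F -> F !=set0 ->
  commensurable_with_family H F <-> exists2 X, F X & commensurable H X.
Proof.
move=> [K [N [_ N0 _ FN]]] [X0 FX0]; split => [HF|[X FX HX] Y FY].
  by exists X0 => //; exact: HF.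
by apply: commensurable_trans HX _; exists N; split => //; exact: FN.
Qed.

(* Main.v *)
(** Schlichting's theorem for subgroups is proved by looking at finite
    intersections whose maximal index in a member of the family is least
    possible; here indices are replaced by sizes of separated sets.
    For a finite nonempty [S] included in [F], let [core2 S] and [core4 S] be the
    intersections of the X^2, respectively of the X^4, with X in [S].
    The Y^2-separated subsets of [core2 S] and of [core4 S], with Y in [F], have
    uniformly bounded size, so there is a largest [t] such that for every [S]
    some Y has Y^2-separated sets p in [core2 S] and q in [core4 S] with
    |p| + |q| = t.  Call [S] strong when no Y does better, and let H be the
    union of the [core2 S] with [S] strong: it is invariant and contains a set
    commensurable with [F].

    It remains to bound the separated subsets of H^2.  Finitely many elements
    of H^2 involve finitely many strong sets; let T be their union, and Y, p, q
    be as above for T.  For each strong [S] included in T, p and q are maximal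
    among the separated subsets of [core2 S] and [core4 S], hence [core2 S] lies
    in p Y^2 and [core4 S] in q Y^2.  If x is in [core2 S] and y in [core2 S'],
    then y is in p Y^2, and x p lies in [core4 S] because p lies in [core2 T],
    hence in [core2 S]; so xy is in q Y^4, which is covered by a bounded number
    of translates of any member of [F]. *)
Require Import Defs.
From mathcomp Require Import all_boot monoid.
From mathcomp Require Import boolp classical_sets functions cardinality.

Local Open Scope classical_set_scope.

(** * Algebra of products, inverses and images of subsets *)

Section SetProducts.
Set Implicit Arguments.
Unset Strict Implicit.
Local Open Scope group_scope.
Variable G : groupType.
Implicit Types A B C D X Y Z : set G.

Lemma image_can (T U : Type) (f : T -> U) (g : U -> T) (A : set T) :
  cancel f g -> g @` (f @` A) = A.
Proof.
by move=> fg; rewrite image_comp -[RHS]image_id; apply: eq_imagel => x _; exact: fg.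
Qed.

Lemma set_mulP A B a b : A a -> B b -> set_mul A B (a * b).
Proof. by move=> Aa Bb; exists a => //; exists b. Qed.

Lemma set_mulSS A B C D :
  A `<=` B -> C `<=` D -> set_mul A C `<=` set_mul B D.
Proof. by move=> AB CD _ [a /AB Ba [c /CD Dc <-]]; exact: set_mulP. Qed.

Lemma set_mulAE A B C : set_mul A (set_mul B C) = set_mul (set_mul A B) C.
Proof.
apply/seteqP; split; first exact: set_mulA.
move=> _ [_ [a Aa [b Bb <-]] [c Cc <-]]; rewrite -mulgA.
by apply: set_mulP => //; exact: set_mulP.
Qed.

Lemma set_mul_inv A B : set_inv (set_mul A B) = set_mul (set_inv B) (set_inv A).
Proof.
apply/seteqP; split=> [_ [_ [a Aa [b Bb <-]] <-]|_ [_ [b Bb <-] [_ [a Aa <-] <-]]].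
  by rewrite invgM; apply: set_mulP; [exists b | exists a].
by exists (a * b); [exact: set_mulP | rewrite invgM].
Qed.

Lemma set_inv_sym A a : A = set_inv A -> A a -> A a^-1.
Proof. by move=> {2}-> Aa; exists a. Qed.

Lemma sym_set_inv A : (forall a, A a -> A a^-1) -> A = set_inv A.
Proof.
move=> sA; apply/seteqP; split=> [a Aa|_ [a /sA Aa <-]//].
by exists a^-1; [exact: sA | rewrite invgK].
Qed.

Lemma set_mul_sym A : A = set_inv A -> set_mul A A = set_inv (set_mul A A).
Proof. by move=> sA; rewrite set_mul_inv -sA. Qed.

Lemma set_mul_image (f : G -> G) A B : {morph f : x y / x * y} ->
  f @` set_mul A B = set_mul (f @` A) (f @` B).
Proof.
move=> fM; apply/seteqP; split=> [_ [_ [a Aa [b Bb <-]] <-]|].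
  by rewrite fM; apply: set_mulP; [exists a | exists b].
by move=> _ [_ [a Aa <-] [_ [b Bb <-] <-]]; exists (a * b); [exact: set_mulP|].
Qed.

End SetProducts.

(** * Coverings, colourings and separated sequences *)

Section Covering.
Set Implicit Arguments.
Unset Strict Implicit.
Local Open Scope group_scope.
Local Open Scope card_scope.
Variable G : groupType.
Implicit Types (A B C D Z : set G) (u s : seq G).

Definition covered (n : nat) A B : Prop :=
  exists Z, Z #<= `I_n /\ A `<=` set_mul Z B.

Lemma card_le_II_seq n Z :
  Z #<= `I_n -> exists s, size s <= n /\ Z = [set` s].
Proof.
move=> cZ; exists (finmap.enum_fset (fset_set Z)); split.
  exact: geq_card_fset_set.
have Zfin : finite_set Z by apply: card_le_finite cZ (finite_II n).
by rewrite -[LHS]fset_setK.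
Qed.

Lemma card_seq_le_II n s : size s <= n -> [set` s] #<= `I_n.
Proof.
move=> sn; apply: (@card_le_trans _ _ _ (nth 1 s @` `I_n)).
  apply: subset_card_le => x /= xs; exists (index x s); last by rewrite nth_index.
  by apply: leq_trans sn; rewrite index_mem.
exact: card_image_le.
Qed.

Lemma covered_sub n A B C : A `<=` B -> covered n B C -> covered n A C.
Proof.
by move=> AB [Z [cZ BZC]]; exists Z; split=> //; exact: subset_trans BZC.
Qed.

Lemma covered_subr n A B C : B `<=` C -> covered n A B -> covered n A C.
Proof.
move=> BC [Z [cZ AZB]]; exists Z; split=> //.
by apply: subset_trans AZB _; exact: set_mulS.
Qed.

Lemma covered_trans m n A B C :
  covered m A B -> covered n B C -> covered (m * n) A C.
Proof.
move=> [Y [cY AYB]] [Z [cZ BZC]]; exists (set_mul Y Z).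
split; first exact: card_set_mul.
by rewrite -set_mulAE; apply: subset_trans AYB _; exact: set_mulS.
Qed.

Lemma covered_mulr n A B C :
  covered n A B -> covered n (set_mul A C) (set_mul B C).
Proof.
move=> [Z [cZ AZB]]; exists Z; split=> //.
by rewrite set_mulAE; apply: set_mulSS.
Qed.

Lemma covered_leq m n A B : (m <= n)%N -> covered m A B -> covered n A B.
Proof.
move=> mn [Z [cZ AZB]]; exists Z; split=> //.
by apply: card_le_trans cZ _; rewrite card_le_II.
Qed.

(* [A] is a finite union of sets [P] with P^-1 P included in [B]; unlike being
   covered by translates of [B], this is stable under intersections in [B]. *)
Definition colored (T : finType) A B : Prop :=
  exists c : G -> T, forall x y, A x -> A y -> c x = c y -> B (x^-1 * y).

(** An element of [A] is coloured by the index of a translate of [B] containing it. The extra colour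
    keeps the type inhabited when [n] is 0, as elements outside [A] need a default. *)
Lemma covered_colored n A B :
  covered n A B -> colored 'I_n.+1 A (set_mul (set_inv B) B).
Proof.
move=> [_ [/card_le_II_seq[s [sn ->]] As]].
have : forall a, exists i : 'I_n.+1, A a -> B ((nth 1 s i)^-1 * a).
  move=> a; have [Aa|nAa] := pselect (A a); last by exists ord0.
  have [z zs [b Bb <-]] := As a Aa.
  have zn : index z s < n.+1 by rewrite ltnS (leq_trans (index_size z s)).
  by exists (Ordinal zn) => _ /=; rewrite nth_index// mulKg.
move=> /choice[c cP]; exists c => x y Ax Ay cxy.
have -> : x^-1 * y = ((nth 1 s (c x))^-1 * x)^-1 * ((nth 1 s (c y))^-1 * y).
  by rewrite cxy invgM invgK mulgA mulgK.
by apply: set_mulP; [exists ((nth 1 s (c x))^-1 * x) => //; exact: cP | exact: cP].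
Qed.

(** Representatives of the colour classes serve as translating elements; [1] stands in for an empty
    class. *)
Lemma colored_covered (T : finType) A B : colored T A B -> covered #|T| A B.
Proof.
move=> [c cP].
have : forall t, exists r : G, forall a, A a -> c a = t -> A r /\ c r = t.
  move=> t; have [[a [Aa cat]]|nt] := pselect (exists a, A a /\ c a = t).
    by exists a.
  by exists 1 => a Aa cat; case: nt; exists a.
move=> /choice[r rP]; exists [set` map r (enum T)]; split.
  by apply: card_seq_le_II; rewrite size_map -cardT.
move=> a Aa; have [Ar car] := rP (c a) a Aa erefl.
rewrite -[a](mulVKg (r (c a))); apply: set_mulP; last exact: cP.
by apply: map_f; rewrite mem_enum.
Qed.

Lemma colored_setI (T U : finType) A B C :
  colored T A B -> colored U A C -> colored (T * U)%type A (B `&` C).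
Proof.
move=> [c cP] [d dP]; exists (fun x => (c x, d x)) => x y Ax Ay [cxy dxy].
by split; [exact: cP | exact: dP].
Qed.

(** The separated sets, as sequences. When [1] is in [B] there are no repetitions, so [size] is the
    cardinality. *)
Definition packed A B u : bool :=
  all (fun x => `[< A x >]) u && pairwise (fun x y => ~~ `[< B (x^-1 * y) >]) u.

Lemma packed_mem A B u x : packed A B u -> x \in u -> A x.
Proof. by move=> /andP[/allP uA _] /uA /asboolP. Qed.

Lemma packed_sub A B C u : A `<=` B -> packed A C u -> packed B C u.
Proof.
move=> AB /andP[/allP uA uP]; apply/andP; split=> //.
by apply/allP => x /uA /asboolP Ax; apply/asboolP; exact: AB.
Qed.

(** Pigeonhole: two entries of the same colour would not be separated. *)
Lemma packed_size (T : finType) A B u :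
  colored T A B -> packed A B u -> size u <= #|T|.
Proof.
move=> [c cP] /andP[uA uB].
rewrite -(size_map c) -(card_uniqP _) ?max_card// uniq_pairwise pairwise_map.
apply: sub_in_pairwise uA uB => x y /asboolP Ax /asboolP Ay /asboolPn nB /=.
by apply/eqP => cxy; apply: nB; exact: cP.
Qed.

(** If [x] cannot be prepended, some entry [y] has [x^-1 * y] in [B], and symmetry puts [y^-1 * x]
    in [B]. *)
Lemma packed_maximal A B u x : B = set_inv B -> packed A B u ->
  ~~ packed A B (x :: u) -> A x -> set_mul [set` u] B x.
Proof.
move=> sB /andP[uA uB] + Ax.
rewrite /packed pairwise_cons /= uA uB asboolT//= andbT => /allPn[y yu].
rewrite negbK => /asboolP Bxy; rewrite -[x](mulVKg y); apply: set_mulP => //.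
by rewrite -[_ * _]invgK invgM invgK; exact: set_inv_sym.
Qed.

Lemma packed_covered n A B : B = set_inv B ->
  (forall u, packed A B u -> size u <= n) -> covered n A B.
Proof.
move=> sB un.
pose P k := `[< exists2 u, packed A B u & size u = k >].
have exP : exists k, P k by exists 0; apply/asboolP; exists [::].
have ubP k : P k -> k <= n by move=> /asboolP[u /un + <-].
case: (ex_maxnP exP ubP) => _ /asboolP[u pu <-] umax.
exists [set` u]; split; first exact: card_seq_le_II (un _ pu).
move=> x Ax; apply: packed_maximal (pu) _ Ax => //; apply/negP => pxu.
suff: size u < size u by rewrite ltnn.
by apply: (umax (size u).+1); apply/asboolP; exists (x :: u).
Qed.

Lemma packed_image (f : G -> G) A B u : {morph f : x y / x * y} -> injective f ->
  packed A B u -> packed (f @` A) (f @` B) (map f u).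
Proof.
move=> fM fI /andP[/allP uA uB]; apply/andP; split.
  by apply/allP => _ /mapP[x /uA/asboolP Ax ->]; apply/asboolP; exists x.
rewrite pairwise_map; apply: sub_pairwise uB => x y /= /asboolPn nB.
apply/asboolPn => -[z Bz fz]; apply: nB; suff <- : z = x^-1 * y by [].
by apply: fI; apply: (@mulgI _ (f x)); rewrite fz mulVKg -fM mulVKg.
Qed.

End Covering.

(** * Levels of finite subfamilies and their transport by automorphisms *)

Section StrongSubfamilies.
Set Implicit Arguments.
Unset Strict Implicit.
Local Open Scope group_scope.
Variables (G : groupType) (F : set (set G)).
Implicit Types (X Y H : set G) (S T : set (set G)) (u : seq G).

Definition sq X := set_mul X X.

Definition core2 S : set G := [set g | forall X, S X -> sq X g].
Definition core4 S : set G := [set g | forall X, S X -> sq (sq X) g].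

Definition admissible S : Prop := [/\ finite_set S, S !=set0 & S `<=` F].

Definition level S n : Prop := exists Y u v,
  [/\ F Y, packed (core2 S) (sq Y) u, packed (core4 S) (sq Y) v &
      size u + size v = n].

(** Excluding [n.+1] excludes all higher levels, since dropping an entry keeps a sequence
    separated. *)
Definition strong n S : Prop := admissible S /\ ~ level S n.+1.

Definition strong_union n : set G := [set g | exists2 S, strong n S & core2 S g].

Lemma core2_sub S T : S `<=` T -> core2 T `<=` core2 S.
Proof. by move=> ST g gT X /ST; exact: gT. Qed.

Lemma core4_sub S T : S `<=` T -> core4 T `<=` core4 S.
Proof. by move=> ST g gT X /ST; exact: gT. Qed.

Lemma core2_mul S x y : core2 S x -> core2 S y -> core4 S (x * y).
Proof. by move=> Sx Sy X SX; apply: set_mulP; [exact: Sx | exact: Sy]. Qed.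

Lemma admissibleU S T : admissible S -> admissible T -> admissible (S `|` T).
Proof.
move=> [fS [X SX] SF] [fT _ TF]; split; first by rewrite finite_setU.
  by exists X; left.
by rewrite subUset.
Qed.

Section Automorphisms.
Variable f : G -> G.
Hypotheses (fM : {morph f : x y / x * y}) (fI : injective f).
Hypothesis fF : forall X, F X -> F (f @` X).

Lemma sq_image X : f @` sq X = sq (f @` X).
Proof. exact: set_mul_image. Qed.

Lemma core2_image S : core2 S `<=` f @^-1` core2 [set f @` X | X in S].
Proof. by move=> g gS _ [X SX <-]; rewrite -sq_image; exists g => //; exact: gS. Qed.

Lemma core4_image S : core4 S `<=` f @^-1` core4 [set f @` X | X in S].
Proof. by move=> g gS _ [X SX <-]; rewrite -!sq_image; exists g => //; exact: gS. Qed.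

Lemma admissible_image S : admissible S -> admissible [set f @` X | X in S].
Proof.
move=> [fS [X SX] SF]; split; first exact: finite_image.
  by exists (f @` X), X.
by move=> _ [Z /SF FZ <-]; exact: fF.
Qed.

Lemma level_image S n : level S n -> level [set f @` X | X in S] n.
Proof.
move=> [Y [u [v [FY pu pv <-]]]]; exists (f @` Y), (map f u), (map f v).
rewrite !size_map -sq_image; split=> //; first exact: fF.
  apply: packed_sub (packed_image fM fI pu) => //.
  by move=> _ [x /core2_image xS <-].
apply: packed_sub (packed_image fM fI pv) => //.
by move=> _ [x /core4_image xS <-].
Qed.

End Automorphisms.

Lemma strong_union_image n (f g : G -> G) : {morph f : x y / x * y} ->
  {morph g : x y / x * y} -> cancel f g -> cancel g f ->
  (forall X, F X -> F (f @` X)) -> (forall X, F X -> F (g @` X)) ->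
  f @` strong_union n `<=` strong_union n.
Proof.
move=> fM gM fg gf fF gF _ [x [S [aS nS] xS] <-].
exists [set f @` X | X in S]; last exact: core2_image.
split; first exact: admissible_image.
(* A level [n.+1] of the image family would be carried back to [S] by [g]. *)
move=> /(level_image gM (can_inj gf) gF).
by rewrite (@image_can _ _ (image^~ f) (image^~ g))// => X; exact: image_can.
Qed.

(** * Uniform bounds and existence of strong subfamilies *)

Variables K N : nat.
Hypothesis approxF : forall X, F X -> approximate_subgroup_by K X.
Hypothesis commF : forall X Y, F X -> F Y -> commensurable_by N X Y.

Lemma family_sym X : F X -> X = set_inv X.
Proof. by case/approxF. Qed.

Lemma sq_sym X : F X -> sq X = set_inv (sq X).
Proof. by move=> /family_sym; exact: set_mul_sym. Qed.

Lemma covered_family X Y : F X -> F Y -> covered N X Y.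
Proof. by move=> FX /(commF FX)[Z [Z' [cZ _ XZY _]]]; exists Z. Qed.

Lemma covered_sq X : F X -> covered K (sq X) X.
Proof. by case/approxF. Qed.

(** Each [K] pays for replacing one [sq X] by [X], three times in all. *)
Lemma covered_sq_sq X : F X -> covered (K * (K * K)) (sq (sq X)) X.
Proof.
move=> FX; have c1 := covered_sq FX.
apply: (covered_trans (covered_mulr (sq X) c1)).
by rewrite set_mulAE; apply: covered_trans (c1); exact: covered_mulr.
Qed.

Lemma colored_sq n A Y : F Y -> covered n A Y -> colored 'I_n.+1 A (sq Y).
Proof. by move=> /family_sym sY /covered_colored; rewrite -sY. Qed.

(** For any [X] in [S], the two cores lie in [sq X] and [sq (sq X)], which are covered by translates
    of [Y]; the successors come from [covered_colored]. *)
Lemma level_bound S n : S !=set0 -> S `<=` F -> level S n ->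
  n <= (K * N).+1 + (K * (K * K) * N).+1.
Proof.
move=> [X SX] SF [Y [u [v [FY pu pv <-]]]]; have FX := SF _ SX.
have cXY := covered_family FX FY.
apply: leq_add.
  rewrite -[leqRHS]card_ord; apply: packed_size pu.
  apply: colored_sq => //; apply: covered_trans cXY.
  by apply: covered_sub (covered_sq FX) => g; exact.
rewrite -[leqRHS]card_ord; apply: packed_size pv.
apply: colored_sq => //; apply: covered_trans cXY.
by apply: covered_sub (covered_sq_sq FX) => g; exact.
Qed.

Lemma exists_strong : F !=set0 ->
  exists n, (forall S, admissible S -> level S n) /\ exists S, strong n S.
Proof.
move=> [X FX]; pose P n := `[< forall S, admissible S -> level S n >].
have exP : exists n, P n.
  exists 0; apply/asboolP => S _; exists X, [::], [::]; split => //.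
have aX : admissible [set X].
  by split; [exact: finite_set1 | exists X | move=> _ ->].
have ubP n : P n -> n <= (K * N).+1 + (K * (K * K) * N).+1.
  by move=> /asboolP/(_ _ aX); apply: level_bound; case: aX.
case: (ex_maxnP exP ubP) => n /asboolP Pn nmax; exists n; split => //.
(* Were no [S] strong, every admissible [S] would have level [n.+1], against the maximality of
   [n]. *)
apply: contrapT => nS; suff: n < n by rewrite ltnn.
apply: nmax; apply/asboolP => S aS; apply: contrapT => nlS.
by apply: nS; exists S.
Qed.

(** Colourings multiply under finite intersections. The number depends on [S], which is harmless:
    one strong [S] will do. *)
Lemma covered_core2 S Y : admissible S -> F Y -> exists n, covered n Y (core2 S).
Proof.
move=> [/finite_seqP[s ->] _ sF] FY.
suff [T cT] : exists T : finType, colored T Y (core2 [set` s]).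
  by exists #|T|; exact: colored_covered.
(* Over the empty list [core2] is the whole group, so one colour suffices. *)
elim: s sF => [|X s IH] sF; first by exists unit, (fun=> tt).
have [|T cT] := IH; first by move=> Z Zs; apply: sF; rewrite /= inE Zs orbT.
have FX : F X by apply: sF; rewrite /= mem_head.
exists ('I_N.+1 * T)%type.
have [c cP] := colored_setI (colored_sq FX (covered_family FY FX)) cT.
exists c => x y Yx Yy /(cP x y Yx Yy)[gX gs] Z /=; rewrite inE.
by case/orP => [/eqP ->|/gs].
Qed.

(** * The union of the strong cores is an approximate subgroup *)

Lemma strong_union1 n : (exists S, strong n S) -> strong_union n 1.
Proof.
move=> [S sS]; exists S => // X SX; have [[_ _ /(_ X SX) FX] _] := sS.
by have [X1 _ _] := approxF FX; rewrite -[1]mulg1; exact: set_mulP.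
Qed.

Lemma strong_union_sym n : strong_union n = set_inv (strong_union n).
Proof.
apply: sym_set_inv => g [S sS gS]; exists S => // X SX.
have [[_ _ /(_ X SX) FX] _] := sS.
by apply: set_inv_sym (gS X SX); exact: sq_sym.
Qed.

(** Cores shrink as families grow, so [u] and [v] stay separated for [S]; one more entry in either
    would give [S] level [n.+1]. *)
Lemma strong_cover n S T Y u v : strong n S -> S `<=` T -> F Y ->
  packed (core2 T) (sq Y) u -> packed (core4 T) (sq Y) v -> size u + size v = n ->
  core2 S `<=` set_mul [set` u] (sq Y) /\ core4 S `<=` set_mul [set` v] (sq Y).
Proof.
move=> [_ nS] ST FY pu pv uv.
have {}pu := packed_sub (core2_sub ST) pu.
have {}pv := packed_sub (core4_sub ST) pv.
split=> g gS; apply: packed_maximal gS; rewrite -?sq_sym//; apply/negP => pg.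
  by apply: nS; exists Y, (g :: u), v; split; rewrite //= addSn uv.
by apply: nS; exists Y, u, (g :: v); split; rewrite //= addnS uv.
Qed.

Lemma strong_union_sq_seq n u : (exists S, strong n S) ->
  (forall g, g \in u -> sq (strong_union n) g) ->
  exists T, admissible T /\ forall g, g \in u -> exists S S' x y,
    [/\ strong n S /\ S `<=` T, strong n S' /\ S' `<=` T,
        core2 S x, core2 S' y & g = x * y].
Proof.
move=> [S0 [aS0 _]]; elim: u => [|g u IH] gu; first by exists S0.
have [|T [aT uT]] := IH; first by move=> h hu; apply: gu; rewrite inE hu orbT.
have [x [S sS xS] [y [S' sS' yS'] xyg]] := gu g (mem_head _ _).
exists (T `|` (S `|` S')); split.
  by apply: admissibleU => //; apply: admissibleU; [case: sS | case: sS'].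
move=> h; rewrite inE => /predU1P[->|/uT].
  exists S, S', x, y; split=> //; split=> // Z SZ; right; [by left | by right].
move=> [S1 [S2 [x1 [y1 [[s1 T1] [s2 T2] c1 c2 ->]]]]].
exists S1, S2, x1, y1; split=> //; split=> // Z ?; left; [exact: T1 | exact: T2].
Qed.

(** Although [T] varies with [u], the bound does not: it uses only [size q <= n] and the constants
    of the family. *)
Lemma packed_strong_union_sq n Y u :
  (forall S, admissible S -> level S n) -> (exists S, strong n S) -> F Y ->
  packed (sq (strong_union n)) (sq Y) u ->
  size u <= (n * (K * (K * K)) * N).+1.
Proof.
move=> lev exS FY pu.
have [|T [aT uT]] := @strong_union_sq_seq n u exS.
  by move=> g; exact: packed_mem pu.
have [W [p [q [FW pp pq pqn]]]] := lev T aT.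
have cu : covered n [set` u] (sq (sq W)).
  exists [set` q]; split.
    by apply: card_seq_le_II; rewrite -pqn leq_addl.
  move=> g /uT[S [S' [x [y [[sS ST] [sS' ST'] xS yS' ->]]]]].
  have [S'p _] := strong_cover sS' ST' FW pp pq pqn.
  have [_ Sq] := strong_cover sS ST FW pp pq pqn.
  have [a ap [w Ww <-]] := S'p y yS'.
  (* With [y = a * w] and [x * a = b * w'], the product [x * y] is [b * (w' * w)]. *)
  have aS : core2 S a by apply: core2_sub ST _ _; exact: packed_mem pp ap.
  have [b bq [w' Ww' xa]] := Sq _ (core2_mul xS aS).
  by rewrite mulgA -xa -mulgA; do 2![apply: set_mulP => //].
have {}cu : covered (n * (K * (K * K)) * N) [set` u] Y.
  apply: covered_trans (covered_family FW FY).
  exact: covered_trans cu (covered_sq_sq FW).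
(* [u] is separated inside its own set of entries, which is all that [cu] covers. *)
rewrite -[leqRHS]card_ord; apply: (packed_size (colored_sq FY cu)).
have /andP[_ uB] := pu; apply/andP; split=> //.
by apply/allP => x xu; apply/asboolP.
Qed.

(** A largest separated sequence covers [sq H] by translates of [sq Y], hence of [Y]; in turn [Y] is
    covered by translates of one strong core, hence of [H]. *)
Lemma strong_union_approximate n :
  (forall S, admissible S -> level S n) -> (exists S, strong n S) ->
  forall Y, F Y ->
    approximate_subgroup (strong_union n) /\ commensurable (strong_union n) Y.
Proof.
move=> lev exS Y FY; set H := strong_union n.
have H1 : H 1 by exact: strong_union1.
have [m cHHY] : exists m, covered m (sq H) Y.
  eexists; apply: covered_trans (covered_sq FY).
  apply: packed_covered; first exact: sq_sym.
  by move=> u; exact: packed_strong_union_sq.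
have [k cYH] : exists k, covered k Y H.
  have [S sS] := exS; have [k cY] := covered_core2 (proj1 sS) FY.
  by exists k; apply: covered_subr cY => g gS; exists S.
split.
  exists (m * k).+1; split => //; split => //; first exact: strong_union_sym.
  exact: covered_leq (leqnSn _) (covered_trans cHHY cYH).
have cHY : covered m H Y.
  by apply: covered_sub cHHY => g Hg; rewrite -[g]mulg1; exact: set_mulP.
exists (maxn m k).+1; split => //.
have [Z0 [cZ0 HZ]] := covered_leq (leqW (leq_maxl m k)) cHY.
have [Z1 [cZ1 YZ]] := covered_leq (leqW (leq_maxr m k)) cYH.
by exists Z0, Z1.
Qed.

End StrongSubfamilies.

Theorem mainTheorem1 (G : groupType) (F : set (set G))
    (hF : uniform_commensurable_family F) :
  exists H : set G,
    [/\ approximate_subgroup H,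
        commensurable_with_family H F &
        forall sigma : {multiplicative G -> G}, bijective sigma ->
          [set sigma @` X | X in F] = F -> sigma @` H = H].
Proof.
have [F0|Fn0] := pselect (F !=set0); last first.
  (* For the empty family commensurability is vacuous, and the whole group is invariant. *)
  exists setT; split.
  - exists 1; split=> //; split=> //.
      by apply/seteqP; split=> // x _; exists (x^-1)%g; rewrite ?invgK.
    exists [set` [:: 1%g]]; split; first exact: card_seq_le_II.
    by move=> x _; exists 1%g; [rewrite /= inE | exists x; rewrite ?mul1g].
  - by move=> X FX; case: Fn0; exists X.
  - move=> sigma [tau _ ts] _; apply/seteqP; split=> // x _.
    by exists (tau x).
have [K [N [_ _ approxF commF]]] := hF.
have [n [lev exS]] := exists_strong approxF commF F0.
have sa := strong_union_approximate approxF commF lev exS.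
exists (strong_union F n); split.
- by have [X FX] := F0; case: (sa X FX).
- by move=> X /sa[].
move=> sigma [tau st ts] sF.
have sM : {morph sigma : x y / (x * y)%g} by exact: gmulfM.
(* The inverse [tau] is also an automorphism stabilizing [F]; it yields the reverse inclusion. *)
have tM : {morph tau : x y / (x * y)%g}.
  by move=> x y; apply: (can_inj st); rewrite sM !ts.
have sF' X : F X -> F (sigma @` X) by move=> FX; rewrite -sF; exists X.
have tF' X : F X -> F (tau @` X).
  by rewrite -{1}sF => -[Z FZ <-]; rewrite image_can.
apply/seteqP; split; first exact: (strong_union_image sM tM st ts).
move=> x Hx; exists (tau x); last exact: ts.
by apply: (strong_union_image tM sM ts st) => //; exists x.
Qed.
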